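(* Consider the $N$-player game described in the context in which each player $i$ minimizes $\mathcal J^i(x_0,\gamma)$ over its feedback policy $\gamma^i$ subject to the stochastic linear dynamics and the affine constraint $\bm g(\mathbf x)=\bm l^\top\mathbf x+\bm c\le0$, where $\mathbf x$ is the expected state trajectory and $\bm l,\bm c$ are the constraint data constructed in the context. Then every feedback generalized Nash equilibrium of this game satisfies the chance constraints $$\mathbb P(x_t\in\mathcal X^k)\ge 1-\epsilon_t^k\qquad\text{for all }k\in\{1,\dots,K\},\ t\in\{1,\dots,T\}.$$
   Context: Dynamics: $x_{t+1}=A_tx_t+\sum_{i=1}^NB^i_tu^i_t+w_t$, $t=0,\dots,T-1$, where $x_t=[x_t^{1\top},\dots,x_t^{N\top}]^\top\in\mathbb R^{n_x}$ stacks the agents' states, $u_t^i\in\mathbb R^{n_u}$, $x_0$ is known and deterministic, and $w_t\sim\mathcal N(0,W_t)$ are independent with known $W_t\succ0$. Policies: $\gamma^i=(\gamma^i_0,\dots,\gamma^i_{T-1})$, $u^i_t=\gamma^i_t(x_t)$, with $\gamma^i_t:\mathbb R^{n_x}\to\mathbb R^{n_u}$; $\gamma=(\gamma^i,\gamma^{-i})$. Costs: $\mathcal J^i(x_0,\gamma)=\mathbb E\bigl[\sum_{t=0}^{T-1}(x_{t+1}^\top Q^i_{t+1}x_{t+1}+(u^i_t)^\top R^i_tu^i_t)\bigr]$, $Q^i_t\succeq0$, $R^i_t\succ0$. State distribution (standing convention of the paper): $x_t\sim\mathcal N(\mu_t,\Sigma_t)$ with $\mu_t=\mathbb E[x_t]$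 and covariance propagated by $\Sigma_{t+1}=A_t\Sigma_tA_t^\top+W_t$, $\Sigma_0=0$. Safe sets: each $\mathcal X^k$, with risk level $\epsilon^k_t\in(0,1)$, is of one of two forms. (i) A box $\{x: x_{\min}\le x\le x_{\max}\}$. (ii) A collision-avoidance set $\{x:\|x^i-x^j\|_C^2\ge R^2\}$ for a pair of agents $i\ne j$, where $\|y\|_C=\sqrt{y^\top Cy}$, $C\succeq0$, $R>0$. Affine constraints: $\Psi^{-1}$ is the inverse cumulative distribution function of $\mathcal N(0,1)$, and $\|y\|_P=\sqrt{y^\top Py}$. For a set of form (ii) and time $t\in\{1,\dots,T\}$, fix a reference distance vector $\bar d^{i,j}_t$ with $\|\bar d_t^{i,j}\|_C=R$. Let $\mu_t^{ij}$ and $\Sigma_t^{ij}$ be the mean and covariance of $d^{i,j}_t=x_t^i-x_t^j$ (computed from $\mu_t,\Sigma_t$). The associated affine constraint on $\mathbb E[x_t]$ is $$-(C\bar d^{i,j}_t)^\top(\mu^{ij}_t-\bar d^{i,j}_t)+\Psi^{-1}(1-\epsilon^k_t)\,\|C\bar d_t^{i,j}\|_{\Sigma_t^{ij}}\le0 .$$ For a set of form (i), write the box as a finite intersection of half-spaces $\{x:a_q^\top x\le b_q\}$ with risks $\epsilon^{k}_{t,q}>0$, $\sum_q\epsilon^k_{t,q}\le\epsilon^k_t$. The associated affine constraints are $a_q^\top\mathbb E[x_t]-b_q+\Psi^{-1}(1-\epsilon^k_{t,q})\|a_q\|_{\Sigma_t}\le0$. All these constraints, over all $t\in\{1,\dots,T\}$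 and all $k$ ($M$ in total), are stacked as $\bm g(\mathbf x)=\bm l^\top\mathbf x+\bm c\le0$ with $\bm l\in\mathbb R^{Tn_x\times M}$, $\bm c\in\mathbb R^M$, where $\bm l$ acts on $(\mathbb E x_1,\dots,\mathbb E x_T)$. Feedback generalized Nash equilibrium of the reformulated game: a policy profile $\gamma^*$ satisfying the dynamics and $\bm g(\mathbf x)\le0$ such that for every $i$, $\mathcal J^i(x_0,\gamma^* )\le\mathcal J^i(x_0,(\gamma^i,\gamma^{-i*}))$ for all $\gamma^i$ such that $(\gamma^i,\gamma^{-i*})$ satisfies the dynamics and $\bm g(\mathbf x)\le0$. *)

(* Defs.v *)
(* Library: MathComp with MathComp-Analysis. *)
From HB Require Import structures.
From mathcomp Require Import all_boot all_order all_algebra.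
From mathcomp Require Import all_classical all_reals all_analysis.
Set Implicit Arguments.
Unset Strict Implicit.
Unset Printing Implicit Defensive.
Import Order.TTheory GRing.Theory Num.Theory.
Import numFieldNormedType.Exports.
Local Open Scope classical_set_scope.
Local Open Scope ring_scope.

Section LinearAlgebra.
Context {R : realType}.

Definition dotv n (a x : 'cV[R]_n) : R := (a^T *m x) 0 0.

Definition quad n (M : 'M[R]_n) (x : 'cV[R]_n) : R := (x^T *m M *m x) 0 0.

Definition wnorm n (M : 'M[R]_n) (x : 'cV[R]_n) : R := Num.sqrt (quad M x).

Definition posdef n (M : 'M[R]_n) : Prop :=
  M^T = M /\ forall x : 'cV[R]_n, x != 0 -> 0 < quad M x.

Definition possemidef n (M : 'M[R]_n) : Prop :=
  M^T = M /\ forall x : 'cV[R]_n, 0 <= quad M x.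

End LinearAlgebra.

(* R^n with its Borel sigma-algebra; the carrier is convertible to 'cV[R]_n. *)
Definition borel_cV (R : realType) (n : nat) :=
  g_sigma_algebraType (@open 'cV[R]_n).

Section Probability.
Context {R : realType}.

Definition std_normal_cdf (z : R) : R := fine (normal_prob 0 1 `]-oo, z]).

(* [pinv] picks a preimage under the CDF; the value is meaningful (and unique)
   on the range of the CDF, which is the open interval (0, 1). *)
Definition std_normal_icdf : R -> R := pinv [set: R] std_normal_cdf.

(* The univariate normal law N(m, v) of variance v >= 0. The case v = 0 is
   treated apart because [normal_prob m 0] is not the Dirac mass at m. *)
Definition normal_law (m v : R) (E : set R) : \bar R :=
  if v == 0 then dirac m E else normal_prob m (Num.sqrt v) E.

Context d (Omega : measurableType d) (P : probability Omega R).

Definition mean_vec n (X : Omega -> 'cV[R]_n) : 'cV[R]_n :=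
  \col_i fine ('E_P[fun om => X om i 0%R])%E.

(* X ~ N(mu, S): every linear functional a^T X is N(a^T mu, a^T S a). This is
   the definition of the multivariate normal law that allows singular S. *)
Definition gaussian n (X : Omega -> 'cV[R]_n) (mu : 'cV[R]_n) (S : 'M[R]_n)
    : Prop :=
  measurable_fun setT (X : Omega -> borel_cV R n) /\
  forall (a : 'cV[R]_n) (E : set R), measurable E ->
    P [set om | E (dotv a (X om))] = normal_law (dotv a mu) (quad S a) E.

(* Mutual independence of X 0, ..., X T.-1; taking some of the E t to be the
   full space gives the product rule for every subfamily. *)
Definition independent_seq n (T : nat) (X : nat -> Omega -> 'cV[R]_n) : Prop :=
  forall E : nat -> set (borel_cV R n),
    (forall t, (t < T)%N -> measurable (E t)) ->
    P [set om | forall t, (t < T)%N -> E t (X t om)]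
      = (\prod_(t < T) P [set om | E t (X t om)])%E.

End Probability.

(* Dimension of the joint state of N agents with n-dimensional states; the
   joint state is [\mxcol_(i < N) x_i]. *)
Notation xdim N n := (\sum_(i < N) n)%N (only parsing).

Section SafeSets.
Context {R : realType} (N n : nat).
Local Notation nx := (xdim N n).

Definition agent (x : 'cV[R]_nx) (i : 'I_N) : 'cV[R]_n :=
  @submxcol R N (fun=> n) 1 x i.

(* The matrix of x |-> x^i - x^j. *)
Definition diff_mx (i j : 'I_N) : 'M[R]_(n, nx) :=
  @mxrow R N (fun=> n) n (fun l => ((l == i)%:R - (l == j)%:R)%:M).

(* A box, with a half-space representation a_q^T x <= b_q, q < box_nq, and the
   risk box_risk s t q given to half-space q at time t. *)
Record box_data := Box {
  box_min : 'cV[R]_nx;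
  box_max : 'cV[R]_nx;
  box_nq : nat;
  box_a : 'I_box_nq -> 'cV[R]_nx;
  box_b : 'I_box_nq -> R;
  box_risk : nat -> 'I_box_nq -> R }.
Arguments box_a b q : clear implicits.
Arguments box_b b q : clear implicits.
Arguments box_risk b t q : clear implicits.

(* The set |x^i - x^j|_C^2 >= r^2, with the reference distance vectors. *)
Record avoid_data := Avoid {
  av_i : 'I_N;
  av_j : 'I_N;
  av_C : 'M[R]_n;
  av_r : R;
  av_dbar : nat -> 'cV[R]_n }.

Definition safe_data := (box_data + avoid_data)%type.

Definition box_set (s : box_data) : set 'cV[R]_nx :=
  [set x : 'cV[R]_nx | forall l, box_min s l 0 <= x l 0 <= box_max s l 0].

Definition safe_set (s : safe_data) : set 'cV[R]_nx :=
  match s with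
  | inl s => box_set s
  | inr s => [set x : 'cV[R]_nx | av_r s ^+ 2
                <= wnorm (av_C s) (agent x (av_i s) - agent x (av_j s)) ^+ 2]
  end.

(* Standing assumptions on a safe set with risk levels eps t, 1 <= t <= T. *)
Definition safe_data_ok (T : nat) (eps : nat -> R) (s : safe_data) : Prop :=
  match s with
  | inl s =>
      box_set s = [set x : 'cV[R]_nx | forall q, dotv (box_a s q) x <= box_b s q] /\
      forall t, (1 <= t <= T)%N ->
        (forall q : 'I_(box_nq s), 0 < box_risk s t q) /\
        \sum_(q < box_nq s) box_risk s t q <= eps t
  | inr s =>
      [/\ av_i s != av_j s, possemidef (av_C s), 0 < av_r s &
          forall t, (1 <= t <= T)%N -> wnorm (av_C s) (av_dbar s t) = av_r s]
  end.

Definition cons_num (s : safe_data) : nat :=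
  match s with inl s => box_nq s | inr _ => 1%N end.

(* The q-th affine constraint of s at time t is
   (cons_lin s t q)^T mu_t + cons_off S e s t q <= 0, where S is the covariance
   of the state at time t and e = eps t; lemma [cons_avoidE] gives the usual
   form in the case of collision avoidance. *)
Definition cons_lin (s : safe_data) (t : nat) : 'I_(cons_num s) -> 'cV[R]_nx :=
  match s return 'I_(cons_num s) -> 'cV[R]_nx with
  | inl s => fun q => box_a s q
  | inr s => fun _ =>
      - ((diff_mx (av_i s) (av_j s))^T *m (av_C s *m av_dbar s t))
  end.

Definition cons_off (S : 'M[R]_nx) (e : R) (s : safe_data) (t : nat)
    : 'I_(cons_num s) -> R :=
  match s return 'I_(cons_num s) -> R with
  | inl s => fun q =>
      - box_b s q
      + std_normal_icdf (1 - box_risk s t q) * wnorm S (box_a s q)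
  | inr s => fun _ =>
      let D := diff_mx (av_i s) (av_j s) in
      let Cd := av_C s *m av_dbar s t in
      dotv Cd (av_dbar s t)
        + std_normal_icdf (1 - e) * wnorm (D *m S *m D^T) Cd
  end.
Arguments cons_lin s t q : clear implicits.
Arguments cons_off S e s t q : clear implicits.

End SafeSets.
Arguments box_a {R N n} b q.
Arguments box_b {R N n} b q.
Arguments box_risk {R N n} b t q.
Arguments diff_mx {R N n} i j.
Arguments cons_lin {R N n} s t q.
Arguments cons_off {R N n} S e s t q.

Lemma diff_mxE (R : realType) (N n : nat) (i j : 'I_N)
    (x : 'cV[R]_(xdim N n)) :
  diff_mx i j *m x = agent x i - agent x j.
Proof.
rewrite -[in LHS](@submxcolK R N (fun=> n) 1 x) /diff_mx /agent.
rewrite mul_mxrow_mxcol.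
have E k : \sum_(l < N) (l == k)%:R *: @submxcol R N (fun=> n) 1 x l = agent x k.
  rewrite (bigD1 k) //= eqxx scale1r big1 ?addr0 // => l /negbTE ->.
  by rewrite scale0r.
under eq_bigr do rewrite mul_scalar_mx scalerBl.
by rewrite sumrB !E.
Qed.

Lemma cons_avoidE (R : realType) (N n : nat) (S : 'M[R]_(xdim N n)) (e : R)
    (s : avoid_data N n) (t : nat) q (mu : 'cV[R]_(xdim N n)) :
  let D := diff_mx (av_i s) (av_j s) in
  let Cd := av_C s *m av_dbar s t in
  dotv (cons_lin (inr s) t q) mu + cons_off S e (inr s) t q
  = - dotv Cd (agent mu (av_i s) - agent mu (av_j s) - av_dbar s t)
    + std_normal_icdf (1 - e) * wnorm (D *m S *m D^T) Cd.
Proof.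
rewrite /= addrA; congr (_ + _).
rewrite -diff_mxE /dotv mulmxBr [(- _)^T]linearN /= mulNmx
  [(_^T *m _)^T]trmx_mul trmxK mulmxA.
by rewrite [in LHS]mxE [in RHS]mxE opprD [X in _ = _ - X]mxE opprK.
Qed.

(* Data of the game. Time-indexed families are indexed by nat; only the times
   0, ..., T-1 for g_A, g_B, g_W, g_R and 1, ..., T for g_Q, g_eps matter. *)
Record game (R : realType) (N n nu T K : nat) := Game {
  g_x0 : 'cV[R]_(xdim N n);
  g_A : nat -> 'M[R]_(xdim N n);
  g_B : 'I_N -> nat -> 'M[R]_(xdim N n, nu);
  g_W : nat -> 'M[R]_(xdim N n);
  g_Q : 'I_N -> nat -> 'M[R]_(xdim N n);
  g_R : 'I_N -> nat -> 'M[R]_nu;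
  g_safe : 'I_K -> safe_data (R := R) N n;
  g_eps : 'I_K -> nat -> R }.

Section Game.
Context {R : realType} {N n nu T K : nat} (G : game R N n nu T K).
Local Notation nx := (xdim N n).

Definition policy := nat -> 'cV[R]_nx -> 'cV[R]_nu.
Definition profile := 'I_N -> policy.

Definition deviate (gam : profile) (i : 'I_N) (gi : policy) : profile :=
  fun j => if j == i then gi else gam j.

Fixpoint Sigma (t : nat) : 'M[R]_nx :=
  if t is s.+1 then g_A G s *m Sigma s *m (g_A G s)^T + g_W G s else 0.

(* A constraint is indexed by a time t : 'I_T, standing for the time t.+1, a
   safe set k and the index of the constraint within the set. *)
Definition cidx : finType := ('I_T * {k : 'I_K & 'I_(cons_num (g_safe G k))})%type.

Definition ncidx : nat := #|{: cidx}|.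

(* The stacked data; the vectors of R^(T n_x) are stacked with [\mxcol]. *)
Definition l_mx : 'M[R]_(\sum_(s < T) nx, ncidx) :=
  \matrix_(r, m)
    let: (t, kq) := enum_val m : cidx in
    @mxcol R T (fun=> nx) 1
      (fun s => if s == t
                then cons_lin (g_safe G (tag kq)) t.+1 (tagged kq)
                else 0) r 0.

Definition c_vec : 'cV[R]_ncidx :=
  \col_m
    let: (t, kq) := enum_val m : cidx in
    cons_off (Sigma t.+1) (g_eps G (tag kq) t.+1) (g_safe G (tag kq))
      t.+1 (tagged kq).

Definition g_fun (x : 'cV[R]_(\sum_(s < T) nx)) : 'cV[R]_ncidx :=
  l_mx^T *m x + c_vec.

Context d (Omega : measurableType d) (P : probability Omega R).
Variable w : nat -> Omega -> 'cV[R]_nx.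

Fixpoint state (gam : profile) (t : nat) (om : Omega) : 'cV[R]_nx :=
  if t is s.+1 then
    g_A G s *m state gam s om
      + \sum_(i < N) g_B G i s *m gam i s (state gam s om) + w s om
  else g_x0 G.

Definition mean_traj (gam : profile) : 'cV[R]_(\sum_(s < T) nx) :=
  @mxcol R T (fun=> nx) 1 (fun s => mean_vec P (state gam s.+1)).

(* The integrand is nonnegative in the games considered, so that the
   expectation is always defined, possibly +oo. *)
Definition cost (gam : profile) (i : 'I_N) : \bar R :=
  expectation P (fun om =>
    \sum_(t < T) (quad (g_Q G i t.+1) (state gam t.+1 om)
                   + quad (g_R G i t) (gam i t (state gam t om)))).

(* The policies are Borel and the states of the closed loop obey the convention
   x_t ~ N(E x_t, Sigma_t) with Sigma the policy-independent covariance. For a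
   feedback policy this is a restriction on the profile. *)
Definition satisfies_dynamics (gam : profile) : Prop :=
  (forall i t, (t < T)%N ->
     measurable_fun setT (gam i t : borel_cV R nx -> borel_cV R nu)) /\
  (forall t, (t <= T)%N ->
     gaussian P (state gam t) (mean_vec P (state gam t)) (Sigma t)).

Definition feasible (gam : profile) : Prop :=
  satisfies_dynamics gam /\ forall m, g_fun (mean_traj gam) m 0 <= 0.

Definition feedback_gne (gam : profile) : Prop :=
  feasible gam /\
  forall (i : 'I_N) (gi : policy), feasible (deviate gam i gi) ->
    (cost gam i <= cost (deviate gam i gi) i)%E.

End Game.

Lemma g_funE (R : realType) (N n nu T K : nat) (G : game R N n nu T K)
    d (Omega : measurableType d) (P : probability Omega R)
    (w : nat -> Omega -> 'cV[R]_(xdim N n)) (gam : profile)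
    (t : 'I_T) (k : 'I_K) (q : 'I_(cons_num (g_safe G k))) :
  let m : 'I_(ncidx G) := @enum_rank (cidx G) (t, existT _ k q) in
  g_fun G (mean_traj G P w gam) m 0
  = dotv (cons_lin (g_safe G k) t.+1 q) (mean_vec P (state G w gam t.+1))
    + cons_off (Sigma G t.+1) (g_eps G k t.+1) (g_safe G k) t.+1 q.
Proof.
move=> m; rewrite /g_fun mxE [c_vec _ _ _]mxE /m enum_rankK /=; congr (_ + _).
set v := (fun s : 'I_T =>
  (if s == t then cons_lin (g_safe G k) t.+1 q else 0) : 'cV[R]_(xdim N n)).
transitivity (((@mxcol R T (fun=> xdim N n) 1 v)^T *m mean_traj G P w gam) 0 0).
  rewrite !mxE; apply: eq_bigr => r _; congr (_ * _).
  by rewrite !mxE enum_rankK /= mxE.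
have vt : v t = cons_lin (g_safe G k) t.+1 q by rewrite /v eqxx.
have vs s : s != t -> v s = 0 by move=> /negbTE st; rewrite /v st.
move: v vt vs => v vt vs.
rewrite tr_mxcol /mean_traj mul_mxrow_mxcol (bigD1 t) //= [X in _ + X]big1; last first.
  by move=> s /vs ->; rewrite trmx0 mul0mx.
by rewrite addr0 /dotv -vt.
Qed.

(* Main.v *)
(* Every equilibrium is feasible, so the state x_t is Gaussian with covariance
   Sigma_t and its mean satisfies the affine constraints. For a Gaussian vector
   x ~ N(mu, S), the constraint a^T mu - b + Psi^-1(1 - e) |a|_S <= 0 gives
   P(a^T x <= b) >= 1 - e by standardization of a^T x. A box is an intersection
   of half-spaces, and Boole's inequality adds up their risks. For collision
   avoidance with d = x^i - x^j, the constraint is that of the half-space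
   dbar^T C d >= |dbar|_C^2 = R^2, which lies in {|d|_C >= R} because
   |d - dbar|_C^2 >= 0. *)
Require Import Defs.
From HB Require Import structures.
From mathcomp Require Import all_boot all_order all_algebra.
From mathcomp Require Import all_classical all_reals all_analysis.
From mathcomp Require Import measurable_realfun.
From mathcomp Require Import ring lra.
Set Implicit Arguments.
Unset Strict Implicit.
Unset Printing Implicit Defensive.
Import Order.TTheory GRing.Theory Num.Theory.
Import numFieldNormedType.Exports.
Local Open Scope classical_set_scope.
Local Open Scope ring_scope.

(** * Standardization, CDF and quantile function of the univariate normal law *)

Section NormalLaw.
Context {R : realType}.
Implicit Types m s b p x : R.

Lemma normal_pdf_standardize m s x : 0 < s ->
  normal_pdf 0 1 ((x - m) / s) / s = normal_pdf m s x.
Proof.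
move=> s0; rewrite !normal_pdfE ?oner_eq0 ?gt_eqF// /normal_peak /normal_fun.
rewrite subr0 expr1n mul1r mulrAC; congr (_ * expR _).
  by rewrite -mulrnAr sqrtrM ?sqr_ge0// sqrtr_sqr gtr0_norm// invfM mulrC.
by field; rewrite gt_eqF.
Qed.

(** Integration by substitution along the increasing map [y |-> (y - m) / s], whose constant
    derivative [s^-1] is the factor relating the two densities. *)
Lemma normal_prob_standardize m s b : 0 < s ->
  normal_prob m s `]-oo, b] = normal_prob 0 1 `]-oo, (b - m) / s].
Proof.
move=> s0; rewrite /normal_prob.
have dF x : is_derive (x : R^o) 1 (fun y : R^o => (y - m) / s : R^o) s^-1.
  by apply: is_derive_eq; rewrite scaler0 add0r subr0 [LHS]mulr1.
have F'E : (fun y : R^o => (y - m) / s : R^o)^`()%classic = cst s^-1.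
  by apply/funext => x; rewrite derive1E; apply: derive_val.
rewrite (@increasing_ge0_integration_by_substitutionNy _
  (fun y => (y - m) / s) (normal_pdf 0 1) b) ?F'E.
- apply: eq_integral => x _; congr (_%:E).
  by rewrite !fctE /= normal_pdf_standardize.
- by move=> x y _ _ xy; rewrite ltr_pM2r ?invr_gt0// ltrD2r.
- by move=> x _; exact: cvg_cst.
- exact: is_cvg_cst.
- exact: cvg_cst.
- split; first by move=> x _; exact: ex_derive.
  apply: cvg_at_left_filter.
  apply: (@differentiable_continuous _ _ _ (b : R^o)
    (fun y : R^o => (y - m) / s : R^o)).
  by apply/derivable1_diffP; exact: ex_derive.
- apply/gt0_cvgMlNy; first by rewrite invr_gt0.
  exact: cvg_addrr_Ny.
- apply: continuous_subspaceT; apply: continuous_normal_pdf.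
  exact: oner_neq0.
- by move=> x _; exact: normal_pdf_ge0.
Qed.

Lemma continuous_std_normal_cdf : continuous (std_normal_cdf (R := R)).
Proof.
move=> x; apply: (@differentiable_continuous _ _ _ (x : R^o)
  (std_normal_cdf : R^o -> R^o)).
apply/derivable1_diffP.
(* The fundamental theorem of calculus gives differentiability at points strictly below an upper
   bound; [x + 1] is one such bound. *)
apply: (@continuous_FTC1 _ (normal_pdf 0 1) -oo%O x (x + 1) _ _ _ _).1.
- by rewrite ltrDl.
- exact: integrableS (integrable_normal_pdf 0 1).
- exact: ltNyr.
- exact: (continuous_normal_pdf (oner_neq0 _)).
Qed.

Lemma std_normal_cdf_mono : {homo std_normal_cdf (R := R) : x y / x <= y}.
Proof.
move=> x y xy; rewrite fine_le ?fin_num_measure// le_measure ?inE//.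
exact: subitvPr.
Qed.

(** The identity as a random variable: under [normal_prob 0 1] its [cdf] is [std_normal_cdf], which
    gives access to the limits of a [cdf] at both infinities. *)
Let idR : measurableTypeR R -> R := idfun.

HB.instance Definition _ :=
  @isMeasurableFun.Build _ _ _ _ idR (@measurable_id _ _ setT).

(** A partial inverse is a right inverse on the image, so it suffices that the CDF takes the value
    [p]. Its limits 0 and 1 give points on either side of [p], and the intermediate value theorem
    concludes. *)
Lemma std_normal_icdfK p : 0 < p < 1 -> std_normal_cdf (std_normal_icdf p) = p.
Proof.
move=> /andP[p0 p1]; apply: (pinvK (fun=> point)).
pose X : {RV (normal_prob 0 1 : probability (measurableTypeR R) R) >-> R} :=
  idR.
have cdfE : cdf X = EFin \o std_normal_cdf.
  by apply/funext => x; rewrite /= /std_normal_cdf fineK ?fin_num_measure.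
have [a ap] : exists a, std_normal_cdf a < p.
  have /fine_cvgP[_ /cvgr_lt/(_ _ p0)] := cvg_cdfNy0 X.
  by move=> /filter_ex[a]; rewrite cdfE; exists a.
have [b pb] : exists b, p < std_normal_cdf b.
  have /fine_cvgP[_ /cvgr_gt/(_ _ p1)] := cvg_cdfy1 X.
  by move=> /filter_ex[b]; rewrite cdfE; exists b.
have Fab := lt_trans ap pb.
have ab : a <= b.
  by rewrite leNgt; apply/negP => /ltW/std_normal_cdf_mono; rewrite leNgt Fab.
have [||c _ cE] := @IVT R std_normal_cdf a b p ab.
- exact/continuous_subspaceT/continuous_std_normal_cdf.
- by rewrite (min_idPl (ltW Fab)) (max_idPr (ltW Fab)) !ltW.
by rewrite inE; exists c.
Qed.

End NormalLaw.

(** * Algebra of quadratic forms *)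

Section QuadraticForms.
Context {R : realType}.

Lemma dotvBl n (a b x : 'cV[R]_n) : dotv (a - b) x = dotv a x - dotv b x.
Proof. by rewrite /dotv [(_ - _)^T]linearB mulmxBl mxE [X in _ + X]mxE. Qed.

Lemma dotvBr n (a x y : 'cV[R]_n) : dotv a (x - y) = dotv a x - dotv a y.
Proof. by rewrite /dotv mulmxBr mxE [X in _ + X]mxE. Qed.

Lemma quad_conj m n (A : 'M[R]_(m, n)) (S : 'M[R]_n) (a : 'cV[R]_m) :
  quad (A *m S *m A^T) a = quad S (A^T *m a).
Proof. by rewrite /quad trmx_mul trmxK !mulmxA. Qed.

Lemma quadD n (S S' : 'M[R]_n) (a : 'cV[R]_n) :
  quad (S + S') a = quad S a + quad S' a.
Proof. by rewrite /quad mulmxDr mulmxDl mxE. Qed.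

Lemma quadN n (S : 'M[R]_n) (a : 'cV[R]_n) : quad S (- a) = quad S a.
Proof. by rewrite /quad [(- a)^T]linearN /= mulNmx mulmxN mulNmx opprK. Qed.

Lemma quad0r n (S : 'M[R]_n) : quad S 0 = 0.
Proof. by rewrite /quad mulmx0 mxE. Qed.

Lemma quad0l n (a : 'cV[R]_n) : quad 0 a = 0.
Proof. by rewrite /quad mulmx0 mul0mx mxE. Qed.

Lemma posdef_quad_ge0 n (S : 'M[R]_n) (a : 'cV[R]_n) : posdef S -> 0 <= quad S a.
Proof.
move=> [_ S_gt0]; have [->|/S_gt0/ltW //] := eqVneq a 0.
by rewrite quad0r.
Qed.

(* Expanding [0 <= |y - x|_C^2] replaces the Cauchy-Schwarz inequality. *)
Lemma quad_tangent n (C : 'M[R]_n) (x y : 'cV[R]_n) : possemidef C ->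
  dotv (C *m x) y *+ 2 - quad C x <= quad C y.
Proof.
move=> [CT C_ge0]; have := C_ge0 (y - x).
have CxE u v : (u^T *m C *m v) 0 0 = dotv (C *m u) v :> R.
  by rewrite /dotv trmx_mul CT.
have sym : dotv (C *m y) x = dotv (C *m x) y.
  rewrite -!CxE -[in RHS]CT -[in RHS](trmxK y) -mulmxA -!trmx_mul.
  by rewrite [RHS]mxE mulmxA.
by rewrite /quad !CxE mulmxBr dotvBl !dotvBr sym; lra.
Qed.

End QuadraticForms.

(** * Measurability and Gaussian half-spaces *)

Section Gaussian.
Context {R : realType} d (Omega : measurableType d) (P : probability Omega R).

(** Coordinates are continuous, so they pull the open rays that generate the Borel sets of the line
    back to open sets. *)
Lemma measurable_coord n (X : Omega -> 'cV[R]_n) i :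
  measurable_fun setT (X : Omega -> borel_cV R n) ->
  measurable_fun setT (fun om => X om i 0).
Proof.
move=> mX.
apply: (@measurableT_comp _ _ _ _ _ _
  (fun x : borel_cV R n => (x : 'cV[R]_n) i 0)) => //.
apply: (measurability _ (RGenOInfty.measurableE R)).
move=> _ [_ [a ->] <-]; rewrite setTI.
apply: sub_sigma_algebra.
by apply: open_comp => [x _|]; [exact: coord_continuous|exact: interval_open].
Qed.

Lemma measurable_mulmx n m (A : 'M[R]_(m, n)) (X : Omega -> 'cV[R]_n) i :
  (forall j, measurable_fun setT (fun om => X om j 0)) ->
  measurable_fun setT (fun om => (A *m X om) i 0).
Proof.
move=> mX; under eq_fun do rewrite mxE.
by apply: measurable_sum => j; exact: measurable_funM.
Qed.

Lemma measurable_quad n (C : 'M[R]_n) (X : Omega -> 'cV[R]_n) :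
  (forall j, measurable_fun setT (fun om => X om j 0)) ->
  measurable_fun setT (fun om => quad C (X om)).
Proof.
move=> mX; under eq_fun do rewrite /quad -mulmxA mxE.
apply: measurable_sum => j; apply: measurable_funM; last exact: measurable_mulmx.
by under eq_fun do rewrite mxE; exact: mX.
Qed.

Lemma normal_law_ray (m v b e : R) : 0 <= v -> 0 < e < 1 ->
  m - b + std_normal_icdf (1 - e) * Num.sqrt v <= 0 ->
  ((1 - e)%:E <= normal_law m v `]-oo, b])%E.
Proof.
move=> v0 /andP[e0 e1] mb; rewrite /normal_law; case: eqVneq => [v_eq0|v_neq0].
  (* With zero variance the constraint reads [m <= b], so the Dirac mass lies in the ray and the
     probability is 1. *)
  rewrite diracE mem_set ?lee_fin ?lerBlDr ?lerDl ?ltW//= in_itv/=.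
  by move: mb; rewrite v_eq0 sqrtr0 mulr0 addr0 subr_le0.
have s0 : 0 < Num.sqrt v by rewrite sqrtr_gt0 lt_def v_neq0.
rewrite normal_prob_standardize//.
rewrite -[leRHS]fineK ?fin_num_measure// lee_fin -[leRHS]/(std_normal_cdf _).
(* Writing [1 - e] as a value of the CDF reduces the claim to comparing the quantile with
   [(b - m) / Num.sqrt v], which is the constraint divided by the standard deviation. *)
rewrite -[leLHS]std_normal_icdfK; last by rewrite subr_gt0 e1 gtrBl.
apply: std_normal_cdf_mono; rewrite ler_pdivlMr//.
by move: mb; lra.
Qed.

Lemma gaussian_halfspace n (X : Omega -> 'cV[R]_n) mu S a b e :
  gaussian P X mu S -> 0 <= quad S a -> 0 < e < 1 ->
  dotv a mu - b + std_normal_icdf (1 - e) * wnorm S a <= 0 ->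
  ((1 - e)%:E <= P [set om | (dotv a (X om) <= b)%R])%E.
Proof.
move=> [mX PX] S0 e01 /(normal_law_ray S0 e01).
by rewrite -PX.
Qed.

End Gaussian.

(** Boole's inequality for the union of the complements, each of probability at most [r q]. *)
Lemma probability_forall_ge (R : realType) d (Omega : measurableType d)
    (P : probability Omega R) (I : finType) (A : I -> set Omega) (r : I -> R) :
  (forall q, measurable (A q)) ->
  (forall q, ((1 - r q)%:E <= P (A q))%E) ->
  ((1 - \sum_q r q)%:E <= P [set om | forall q, A q om])%E.
Proof.
move=> mA PA.
have -> : [set om | forall q, A q om] = ~` \big[setU/set0]_(q : I) ~` A q.
  apply/seteqP; split=> om /=.
    by move=> Aom; rewrite -bigcup_seq => -[q _]; apply; exact: Aom.
  by rewrite -bigcup_seq => nA q; apply: contrapT => nAq; apply: nA;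
    exists q => //=; rewrite mem_index_enum.
(* Measurability is carried through the induction because subadditivity requires it of both sets. *)
have [mU PU] : measurable (\big[setU/set0]_(q : I) ~` A q) /\
    (P (\big[setU/set0]_(q : I) ~` A q) <= (\sum_q r q)%:E)%E.
  elim/big_ind2 : _ => [|B y C z [mB PB] [mC PC]|q _].
  - by rewrite measure0.
  - split; first exact: measurableU.
    by apply: le_trans (measureU2 _ mB mC) _; rewrite EFinD leeD.
  - split; first exact: measurableC.
    by rewrite probability_setC// leeBlDr ?fin_num_measure// addeC
      -leeBlDr// -EFinB.
by rewrite probability_setC// EFinB leeB.
Qed.

(** * Covariance of the state and unstacking of the constraints *)

Section StateLaw.
Context {R : realType} {N n nu T K : nat} (G : game R N n nu T K).
Hypothesis W_posdef : forall t, (t < T)%N -> posdef (g_W G t).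

Lemma Sigma_quad_ge0 t a : (t <= T)%N -> 0 <= quad (Sigma G t) a.
Proof.
elim: t a => [|t IH] a tT /=; first by rewrite quad0l.
rewrite quadD quad_conj addr_ge0 ?(IH _ (ltnW tT))//.
exact/posdef_quad_ge0/W_posdef.
Qed.

Context d (Omega : measurableType d) (P : probability Omega R).
Variables (w : nat -> Omega -> 'cV[R]_(xdim N n)).
Variable gam : profile (R := R) (N := N) (n := n) (nu := nu).

Lemma feasible_cons : feasible G P w gam ->
  forall (t : 'I_T) (k : 'I_K) (q : 'I_(cons_num (g_safe G k))),
  dotv (cons_lin (g_safe G k) t.+1 q) (mean_vec P (state G w gam t.+1))
    + cons_off (Sigma G t.+1) (g_eps G k t.+1) (g_safe G k) t.+1 q <= 0.
Proof.
move=> [_ cons] t k q.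
by have := cons (enum_rank (t, existT _ k q)); rewrite g_funE.
Qed.

End StateLaw.

(** * Chance constraints for each form of safe set *)

Section ChanceConstraints.
Context {R : realType} {N n : nat} d (Omega : measurableType d).
Context (P : probability Omega R) (X : Omega -> 'cV[R]_(xdim N n)).
Context (mu : 'cV[R]_(xdim N n)) (S : 'M[R]_(xdim N n)).
Hypotheses (X_gaussian : gaussian P X mu S) (S_ge0 : forall a, 0 <= quad S a).
Variables (T : nat) (eps : nat -> R) (t : nat).
Hypotheses (tT : (1 <= t <= T)%N) (eps_range : 0 < eps t < 1).

Let measurable_X i : measurable_fun setT (fun om => X om i 0).
Proof. by apply: measurable_coord; case: X_gaussian. Qed.

Let measurable_halfspace a b : measurable [set om | dotv a (X om) <= b].
Proof.
rewrite -[X in measurable X]setTI; apply: measurable_fun_le => //.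
exact: measurable_mulmx.
Qed.

Lemma box_chance (s : box_data N n) :
  safe_data_ok T eps (inl s) ->
  (forall q, dotv (cons_lin (inl s) t q) mu
    + cons_off S (eps t) (inl s) t q <= 0) ->
  ((1 - eps t)%:E <= P [set om | safe_set (inl s) (X om)])%E.
Proof.
move=> /= [-> /(_ t tT)[risk_gt0 risk_le]] cons.
apply: (@le_trans _ _ (1 - \sum_q box_risk s t q)%:E).
  by rewrite lee_fin lerD2l lerN2.
apply: (probability_forall_ge
  (A := fun q => [set om | dotv (box_a s q) (X om) <= box_b s q])) => // q.
apply: (gaussian_halfspace X_gaussian (S_ge0 _)); last first.
  by have := cons q; rewrite addrA.
(* A single risk is below 1: the risks are positive, so each is at most their sum, hence at most
   [eps t]. *)
rewrite risk_gt0/=; have /andP[_] := eps_range; apply: le_lt_trans.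
apply: le_trans risk_le; rewrite (bigD1 q)//= lerDl sumr_ge0// => i _.
exact: ltW.
Qed.

Lemma avoid_chance (s : avoid_data N n) :
  safe_data_ok T eps (inr s) ->
  (forall q, dotv (cons_lin (inr s) t q) mu
    + cons_off S (eps t) (inr s) t q <= 0) ->
  ((1 - eps t)%:E <= P [set om | safe_set (inr s) (X om)])%E.
Proof.
move=> /= [_ C_psd r_gt0 /(_ t tT) dbar_r] /(_ ord0).
set C := av_C s; set x := av_dbar s t; set D := diff_mx (av_i s) (av_j s).
(* The norm of [C *m x] for the covariance [D *m S *m D^T] of the distance becomes the [S]-norm of
   [- (D^T *m (C *m x))], the normal vector of the constraint. *)
rewrite /wnorm quad_conj -quadN => cons.
have quad_x : quad C x = av_r s ^+ 2.
  by rewrite -dbar_r sqr_sqrtr//; case: C_psd.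
have wnormE om : wnorm C (agent (X om) (av_i s) - agent (X om) (av_j s)) ^+ 2
    = quad C (D *m X om).
  by rewrite diff_mxE sqr_sqrtr//; case: C_psd.
apply: (@le_trans _ _ (P [set om |
    dotv (- (D^T *m (C *m x))) (X om) <= - dotv (C *m x) x])).
  apply: gaussian_halfspace X_gaussian (S_ge0 _) eps_range _.
  by rewrite opprK -addrA.
apply: le_measure; rewrite ?inE.
- exact: measurable_halfspace.
- under eq_set do rewrite wnormE.
  rewrite -[X in measurable X]setTI; apply: measurable_fun_le => //.
  by apply: measurable_quad => j; exact: measurable_mulmx.
- move=> om /=; rewrite wnormE => half.
  (* On the half-space the inner product of [C *m x] with the distance is at least [av_r s ^+ 2],
     which is also [quad C x]; the tangent bound is then at least twice this number minus itself. *)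
  apply: le_trans (quad_tangent x (D *m X om) C_psd).
  have dotvDE : dotv (- (D^T *m (C *m x))) (X om) = - dotv (C *m x) (D *m X om).
    by rewrite /dotv linearN /= mulNmx [LHS]mxE trmx_mul trmxK mulmxA.
  have dotv_x : dotv (C *m x) x = av_r s ^+ 2.
    by rewrite -quad_x /dotv /quad trmx_mul; case: C_psd => ->.
  move: half; rewrite dotvDE dotv_x lerN2 quad_x => half.
  by rewrite mulr2n -addrA ler_wpDr// ?subr_ge0.
Qed.

End ChanceConstraints.

Theorem lemma1 (R : realType) (N n nu T K : nat) (G : game R N n nu T K)
    (d : measure_display) (Omega : measurableType d) (P : probability Omega R)
    (w : nat -> Omega -> 'cV[R]_(xdim N n))
    (W_posdef : forall t, (t < T)%N -> posdef (g_W G t))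
    (w_gaussian : forall t, (t < T)%N -> gaussian P (w t) 0 (g_W G t))
    (w_indep : independent_seq P T w)
    (Q_psd : forall i t, (1 <= t <= T)%N -> possemidef (g_Q G i t))
    (R_posdef : forall i t, (t < T)%N -> posdef (g_R G i t))
    (eps_range : forall k t, (1 <= t <= T)%N -> 0 < g_eps G k t < 1)
    (safe_ok : forall k, safe_data_ok T (g_eps G k) (g_safe G k))
    (gam : profile) (gam_gne : feedback_gne G P w gam) :
  forall (k : 'I_K) (t : nat), (1 <= t <= T)%N ->
    ((1 - g_eps G k t)%:E
       <= P [set om | safe_set (g_safe G k) (state G w gam t om)])%E.
Proof.
(* Time 0 is out of range; for a successor, [tT] computes to [t < T] and so serves as the bound in
   [Ordinal tT]. *)
move=> k [//|t] tT; have [gam_feas _] := gam_gne.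
have [[_ /(_ t.+1 tT) X_gaussian] _] := gam_feas.
have S_ge0 a := Sigma_quad_ge0 W_posdef a tT.
have := feasible_cons gam_feas (Ordinal tT) (k := k).
move: (safe_ok k); case: (g_safe G k) => s s_ok cons.
- exact: (box_chance X_gaussian S_ge0 tT (eps_range k _ tT)).
- exact: (avoid_chance X_gaussian S_ge0 tT (eps_range k _ tT)).
Qed.
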